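(* Let $n\ge 3$ and $1\le k\le n-1$ be integers. The average squared end to end distance $A(k,n)$ of a subsegment of length $k$ in an ideal ring of length $n$ is $$A(k,n)=\frac{k(n-k)}{n-1}.$$
   Context: An ideal ring $P$ of length $n$ is an $n$-edged equilateral polygon embedded in $\mathbb{R}^3$ with one vertex at the origin, given by unit vectors (edge vectors) $e_1,\dots,e_n\in\mathbb{R}^3$ with $\sum_{i=1}^n e_i=0$; its $k$-th vertex is $v_k=\sum_{i=1}^k e_i$. The space of all such $P$ is $\mathcal{P}_n$. Averages over $\mathcal{P}_n$ are expectations with respect to a fixed probability measure on $\mathcal{P}_n$ under which the edge vectors $e_1,\dots,e_n$ are identically distributed and, for $i\ne j$, the distribution of $e_i\cdot e_j$ does not depend on $i$ and $j$ (standing assumption). Indices of edge vectors are read modulo $n$. For $P\in\mathcal{P}_n$ and $1\le j\le n$, the squared end-to-end distance of length $k$ at $j$ is the squared distance between the two ends of the subsegment consisting of the $k$ consecutive edges starting with $e_j$: $$d_P(k,j)=\left\|\sum_{i=j}^{j+k-1}e_i\right\|^2 .$$ $A(k,n)$ is the average of $d_P(k,j)$ over all $1\le j\le n$ (uniformly) and all $P\in\mathcal{P}_n$. *)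

(* Defs.v *)
From HB Require Import structures.
From mathcomp Require Import all_boot all_order all_algebra.
From mathcomp Require Import all_classical all_reals all_analysis.

Set Implicit Arguments.
Unset Strict Implicit.
Unset Printing Implicit Defensive.

Import Order.TTheory GRing.Theory Num.Theory.
Import numFieldTopology.Exports numFieldNormedType.Exports.

Local Open Scope classical_set_scope.
Local Open Scope ring_scope.

(* Real matrices with their Borel sigma-algebra. *)
Definition borel_mx (R : realType) (m n : nat) : measurableType _ :=
  g_sigma_algebraType (@open 'M[R]_(m, n)).

(* The norm that the library puts on ['rV_3] is the sup norm, hence these
   Euclidean notions. *)
Definition dot (R : realType) (u v : 'rV[R]_3) : R := \sum_(c < 3) u 0 c * v 0 c.

Definition sqnorm (R : realType) (u : 'rV[R]_3) : R := dot u u.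

(* An n-edged polygon based at the origin is given by the n x 3 matrix of its
   edge vectors; indices are shifted by one: row [i] is e_(i+1). *)
Definition edge (R : realType) (n : nat) (i : 'I_n) (M : 'M[R]_(n, 3)) :
  'rV[R]_3 := row i M.

Definition ideal_rings (R : realType) (n : nat) : set 'M[R]_(n, 3) :=
  [set M | (forall i, sqnorm (edge i M) = 1) /\ \sum_i edge i M = 0].

(* [pushforward P X] is the law of [X] under [P]; it is a probability measure
   only for measurable [X], which holds for the edge vectors and for their dot
   products, as these are continuous functions. *)
Definition same_law d d' (T : measurableType d) (T' : measurableType d')
    (R : realType) (P : probability T R) (X Y : T -> T') : Prop :=
  forall B, measurable B -> pushforward P X B = pushforward P Y B.

(* A probability measure on the space of ideal rings is encoded as a Borel
   probability measure on the ambient matrix space which gives mass 1 to the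
   (closed) set of ideal rings. *)
Record ring_measure (R : realType) (n : nat)
    (P : probability (borel_mx R n 3) R) : Prop := {
  ring_measure_support : P (@ideal_rings R n) = 1%E ;
  edges_same_law : forall i j : 'I_n,
    same_law P (edge i : borel_mx R n 3 -> borel_mx R 1 3) (edge j) ;
  dots_same_law : forall i j i' j' : 'I_n, i != j -> i' != j' ->
    same_law P (fun M : borel_mx R n 3 => dot (edge i M) (edge j M))
               (fun M => dot (edge i' M) (edge j' M)) }.

(* [iter i (@ordS n) j] is j + i modulo n. *)
Definition sq_end_to_end (R : realType) (n k : nat) (j : 'I_n)
    (M : 'M[R]_(n, 3)) : R :=
  sqnorm (\sum_(i < k) edge (iter i (@ordS n) j) M).

Definition avg_sq_end_to_end (R : realType) (n : nat)
    (P : probability (borel_mx R n 3) R) (k : nat) : \bar R :=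
  'E_P[fun M => (n%:R^-1 * \sum_(j < n) sq_end_to_end k j M)%R]%E.

(* Main.v *)
Require Import Defs.
From mathcomp Require Import all_boot all_order all_algebra.
From mathcomp Require Import all_classical all_reals all_analysis.
From mathcomp Require Import measurable_realfun ring lra.

Import Order.TTheory GRing.Theory Num.Theory.
Import numFieldTopology.Exports numFieldNormedType.Exports.

Local Open Scope ring_scope.

(** Expanding the square, the squared norm of a sum of [m] distinct edge
    vectors is the sum of all their pairwise dot products.  On an ideal ring
    the [m] diagonal terms equal 1, and the [m (m - 1)] off-diagonal ones share
    the same expectation [c] because they share the same law, so the expected
    squared norm is [m + m (m - 1) c] ([expectation_sqnorm_sum]).

    This single formula is used twice.  With all [n] edges, the sum vanishes
    because the polygon closes up, so [0 = n + n (n - 1) c] and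
    [c = - 1 / (n - 1)] ([common_dot_meanE]).  With the [k] cyclically
    consecutive edges that start at [j], which are distinct as [k <= n]
    ([iter_ordS_inj]), it gives [k - k (k - 1) / (n - 1) = k (n - k) / (n - 1)]
    for every [j], hence also after averaging over [j].

    The analytic part is to make these expectations legitimate.  Dot products
    of edges are Borel, being polynomials in the entries; the set of ideal rings
    is therefore Borel, so identities valid on it hold almost surely; and the
    dot products are almost surely bounded by 1, hence integrable. *)

Lemma sqnorm_sum (R : realType) (I : finType) (u : I -> 'rV[R]_3) :
  sqnorm (\sum_i u i) = \sum_i \sum_j dot (u i) (u j).
Proof.
rewrite /sqnorm /dot.
under [RHS]eq_bigr do rewrite exchange_big/=.
rewrite exchange_big/=; apply: eq_bigr => c _.
rewrite !summxE mulr_suml; apply: eq_bigr => i _.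
by rewrite mulr_sumr.
Qed.

(** Expand [0 <= |u + v|^2] and [0 <= |u - v|^2]. *)
Lemma normr_dot_le1 (R : realType) (u v : 'rV[R]_3) :
  sqnorm u = 1 -> sqnorm v = 1 -> `|dot u v| <= 1.
Proof.
move=> u1 v1.
have sqD : 0 <= \sum_(c < 3) (u 0 c + v 0 c) ^+ 2.
  by apply: sumr_ge0 => c _; exact: sqr_ge0.
have sqB : 0 <= \sum_(c < 3) (u 0 c - v 0 c) ^+ 2.
  by apply: sumr_ge0 => c _; exact: sqr_ge0.
move: u1 v1 sqD sqB.
rewrite /sqnorm /dot !big_ord_recr !big_ord0/=.
move=> u1 v1 sqD sqB.
by rewrite ler_norml; apply/andP; split; nra.
Qed.

Lemma iter_ordS_val (n i : nat) (j : 'I_n) :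
  iter i (@ordS n) j = ((j + i) %% n)%N :> nat.
Proof.
elim: i => [|i IHi]; first by rewrite addn0 modn_small.
by rewrite iterS /= IHi addnS -addn1 modnDml addn1.
Qed.

Lemma iter_ordS_inj (n k : nat) (j : 'I_n) : (k <= n)%N ->
  injective (fun i : 'I_k => iter i (@ordS n) j).
Proof.
move=> kn a b /(congr1 val) /=; rewrite !iter_ordS_val => /eqP.
by rewrite eqn_modDl !modn_small ?(leq_trans (ltn_ord _) kn)// => /eqP/val_inj.
Qed.

Lemma continuous_borel_mx (R : realType) (m n : nat) (f : 'M[R]_(m, n) -> R) :
  continuous f -> measurable_fun [set: borel_mx R m n] f.
Proof.
move=> /continuousP cf; apply: (measurability _ (RGenOpens.measurableE R)).
move=> _ [_ [a [b ->] <-]]; rewrite setTI; apply: sub_sigma_algebra.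
exact/cf/interval_open.
Qed.

Lemma measurable_edge_coord (R : realType) (n : nat) (i : 'I_n) (c : 'I_3) :
  measurable_fun [set: borel_mx R n 3] (fun M => edge i M 0 c).
Proof.
have -> : (fun M : borel_mx R n 3 => edge i M 0 c) = (fun M => M i c).
  by apply/funext => M; rewrite mxE.
by apply: continuous_borel_mx; exact: coord_continuous.
Qed.

Lemma measurable_dot_edge (R : realType) (n : nat) (i j : 'I_n) :
  measurable_fun [set: borel_mx R n 3] (fun M => dot (edge i M) (edge j M)).
Proof.
rewrite /dot; apply: measurable_sum => c.
by apply: measurable_funM; exact: measurable_edge_coord.
Qed.

(** Without this, mass 1 on the ideal rings would not make their complement
    negligible. *)
Lemma measurable_ideal_rings (R : realType) (n : nat) :
  measurable (@ideal_rings R n : set (borel_mx R n 3)).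
Proof.
have -> : @ideal_rings R n =
    ((\bigcap_(i in [set: 'I_n]) ((fun M => sqnorm (edge i M)) @^-1` [set 1]))
    `&` \bigcap_(c in [set: 'I_3])
      ((fun M => (\sum_i edge i M) 0 c) @^-1` [set 0%R]))%classic.
  apply/seteqP; split=> M /= [M1 M0]; split=> //.
  - by move=> i _; exact: M1.
  - by move=> c _; rewrite /= M0 mxE.
  - by move=> i; exact: M1.
  - by apply/rowP => c; rewrite (M0 c)// mxE.
apply: measurableI; apply: fin_bigcap_measurable => //.
- move=> i _; rewrite -[X in measurable X]setTI.
  exact: measurable_dot_edge.
- move=> c _; rewrite -[X in measurable X]setTI.
  suff mc : measurable_fun [set: borel_mx R n 3]
      (fun M => (\sum_i edge i M) 0 c) by exact: mc.
  under eq_fun do rewrite summxE.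
  by apply: measurable_sum => i; exact: measurable_edge_coord.
Qed.

(** Both expectations are the integral of the identity against the law. *)
Lemma expectation_same_law (d : measure_display) (T : measurableType d)
    (R : realType) (P : probability T R) (X Y : T -> R) :
  P.-integrable [set: T] (EFin \o X) -> P.-integrable [set: T] (EFin \o Y) ->
  same_law P X Y -> ('E_P[X] = 'E_P[Y])%E.
Proof.
move=> iX iY XY; rewrite unlock.
have /measurable_EFinP mX := measurable_int _ iX.
have /measurable_EFinP mY := measurable_int _ iY.
have mE : measurable_fun [set: R] (@EFin R) by exact: EFin_measurable.
rewrite -[LHS](integral_pushforward mX mE iX measurableT).
rewrite -[RHS](integral_pushforward mY mE iY measurableT).
apply: eq_measure_integral => A mA _.
exact: XY.
Qed.

Section ring_measure.
Context (R : realType) (n : nat) (P : probability (borel_mx R n 3) R).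
Hypothesis ringP : ring_measure P.

Lemma ae_ideal_rings (Q : 'M[R]_(n, 3) -> Prop) :
  (forall M, ideal_rings M -> Q M) -> {ae P, forall M, Q M}.
Proof.
move=> ringQ; exists (~` (@ideal_rings R n : set (borel_mx R n 3)))%classic.
split.
- by apply: measurableC; exact: measurable_ideal_rings.
- rewrite probability_setC; last exact: measurable_ideal_rings.
  by rewrite (ring_measure_support ringP) subee.
- by move=> M /= nQ /ringQ.
Qed.

Lemma expectation_ae_cst (X : borel_mx R n 3 -> R) (r : R) :
  measurable_fun [set: borel_mx R n 3] X ->
  (forall M, ideal_rings M -> X M = r) -> ('E_P[X] = r%:E)%E.
Proof.
move=> mX Xr; rewrite -(expectation_cst P r) unlock.
apply: ae_eq_integral => //.
- exact/measurable_EFinP.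
- by apply/measurable_EFinP; exact: measurable_cst.
by apply: ae_ideal_rings => M /Xr /= -> _.
Qed.

(** Domination by 1, which holds almost surely only: outside the ideal rings
    the dot products are unbounded. *)
Lemma integrable_dot_edge (i j : 'I_n) :
  P.-integrable [set: borel_mx R n 3]
    (fun M => (dot (edge i M) (edge j M))%:E).
Proof.
have mX : measurable_fun [set: borel_mx R n 3]
   (fun M => (dot (edge i M) (edge j M))%:E).
  by apply/measurable_EFinP; exact: measurable_dot_edge.
apply/integrableP; split => //.
apply: (@le_lt_trans _ _ 'E_P[cst 1%R])%E; last by rewrite expectation_cst ltry.
rewrite unlock.
apply: ae_ge0_le_integral => //.
- exact: measurableT_comp.
- by apply/measurable_EFinP; exact: measurable_cst.
apply: ae_ideal_rings => M [M1 _] _ /=.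
by rewrite lee_fin normr_dot_le1.
Qed.

Lemma integrable_sqnorm_sum (m : nat) (f : 'I_m -> 'I_n) :
  P.-integrable [set: borel_mx R n 3]
    (fun M => (sqnorm (\sum_a edge (f a) M))%:E).
Proof.
under eq_fun do rewrite sqnorm_sum -sumEFin.
apply: integrable_sum => // a _.
under eq_fun do rewrite -sumEFin.
by apply: integrable_sum => // b _; exact: integrable_dot_edge.
Qed.

Section common_dot_mean.
Variable c : R.
Hypothesis dotE : forall i j : 'I_n, i != j ->
  ('E_P[fun M : borel_mx R n 3 => dot (edge i M) (edge j M)] = c%:E)%E.

Lemma expectation_sqnorm_sum (m : nat) (f : 'I_m -> 'I_n) : injective f ->
  ('E_P[fun M : borel_mx R n 3 => sqnorm (\sum_a edge (f a) M)] =
    (m%:R + m%:R * (m%:R - 1) * c)%:E)%E.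
Proof.
move=> f_inj.
have dot_ij i j : ('E_P[fun M : borel_mx R n 3 => dot (edge i M) (edge j M)] =
    (if i == j then 1 else c)%:E)%E.
  have [<-|/dotE//] := eqVneq i j.
  apply: expectation_ae_cst; first exact: measurable_dot_edge.
  by move=> M [M1 _]; exact: M1.
rewrite unlock in dot_ij *.
under eq_integral do rewrite sqnorm_sum -sumEFin.
rewrite integral_sum//; last first.
  move=> a; under eq_fun do rewrite -sumEFin.
  by apply: integrable_sum => // b _; exact: integrable_dot_edge.
(* Each [a] contributes its diagonal term and [m - 1] off-diagonal ones. *)
transitivity (\sum_(a < m) (1 + (m%:R - 1) * c)%:E)%E; last first.
  by rewrite sumEFin sumr_const card_ord -mulr_natl; congr (_%:E); ring.
apply: eq_bigr => a _.
under eq_integral do rewrite -sumEFin.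
rewrite integral_sum//; last by move=> b; exact: integrable_dot_edge.
under eq_bigr do rewrite dot_ij (inj_eq f_inj).
rewrite sumEFin (bigD1 a)//= eqxx; congr (_ + _)%:E.
rewrite (eq_bigr (fun=> c)); last by move=> b; rewrite eq_sym => /negPf ->.
rewrite sumr_const cardC1 card_ord -subn1 -[LHS]mulr_natl natrB//.
exact: leq_ltn_trans (ltn_ord a).
Qed.

(** All [n] edges sum to 0, so [expectation_sqnorm_sum] for the identity reads
    [n (1 + (n - 1) c) = 0]. *)
Lemma common_dot_meanE : (1 < n)%N -> c = - (n%:R - 1)^-1.
Proof.
move=> n1.
have := expectation_sqnorm_sum n id (fun _ _ => id).
rewrite (expectation_ae_cst _ 0)//; last first.
- move=> M [_ M0]; rewrite M0 /sqnorm /dot big1// => a _.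
  by rewrite mxE mul0r.
- apply/measurable_EFinP.
  by have := measurable_int _ (integrable_sqnorm_sum n id).
have n0 : n%:R != 0 :> R by rewrite pnatr_eq0 -lt0n ltnW.
have nB1 : n%:R - 1 != 0 :> R by rewrite subr_eq0 pnatr_eq1 gtn_eqF.
move=> [/esym e].
have {}e : n%:R * (1 + (n%:R - 1) * c) = 0 by rewrite -e; ring.
move/eqP: e; rewrite mulf_eq0 (negPf n0)/= addrC addr_eq0 => /eqP e.
by apply: (mulfI nB1); rewrite e mulrN divff.
Qed.

Lemma avg_sq_end_to_endE (k : nat) : (0 < n)%N -> (k <= n)%N ->
  avg_sq_end_to_end P k = (k%:R + k%:R * (k%:R - 1) * c)%:E.
Proof.
move=> n0 kn; rewrite /avg_sq_end_to_end unlock.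
have iS j : P.-integrable [set: borel_mx R n 3]
    (fun M => (sq_end_to_end k j M)%:E).
  exact: integrable_sqnorm_sum.
under eq_integral do rewrite EFinM -sumEFin.
rewrite integralZl//; last exact: integrable_sum.
rewrite integral_sum//.
rewrite (eq_bigr (fun=> (k%:R + k%:R * (k%:R - 1) * c)%:E)); last first.
  move=> j _; have := expectation_sqnorm_sum k _ (iter_ordS_inj n k j kn).
  by rewrite unlock.
rewrite sumEFin sumr_const card_ord -EFinM -[X in _ * X]mulr_natl mulKf//.
by rewrite pnatr_eq0 -lt0n.
Qed.

End common_dot_mean.

End ring_measure.

Theorem theorem3 (R : realType) (n k : nat)
    (P : probability (borel_mx R n 3) R) :
  (3 <= n)%N -> (1 <= k <= n - 1)%N -> ring_measure P ->
  avg_sq_end_to_end P k = (k%:R * (n%:R - k%:R) / (n%:R - 1))%:E.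
Proof.
move=> n3 /andP[_ kn] ringP.
have n1 : (1 < n)%N by exact: ltnW.
have n0 : (0 < n)%N by exact: ltnW.
pose i0 := Ordinal n0; pose i1 := Ordinal n1.
pose X i j (M : borel_mx R n 3) := dot (edge i M) (edge j M).
have iX i j : P.-integrable setT (EFin \o X i j).
  exact: integrable_dot_edge.
(* The reference pair is the first two edges; any pair of distinct ones does. *)
have dotE i j : i != j -> ('E_P[X i j] = (fine 'E_P[X i0 i1])%:E)%E.
  move=> ij; rewrite fineK; last exact/expectation_fin_num/Lfun1_integrable.
  by apply: expectation_same_law => //; exact: (dots_same_law ringP).
rewrite (avg_sq_end_to_endE _ _ _ ringP _ dotE)//; last first.
  by rewrite (leq_trans kn)// leq_subr.
rewrite (common_dot_meanE _ _ _ ringP _ dotE)//; congr (_%:E).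
have nB1 : n%:R - 1 != 0 :> R by rewrite subr_eq0 pnatr_eq1 gtn_eqF.
by field.
Qed.
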